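(* Let $\mathcal{G}_b=(\mathcal{A}_b\cup\mathcal{B}_b,\mathcal{E}_b)$ be a bipartite graph with edge weights $w:\mathcal{E}_b\to\mathbb{R}$, and let $\mathcal{M}$ be a maximum cardinality matching (MCM) of $\mathcal{G}_b$. If $\mathcal{M}$ is a solution to the Sequential Bottleneck Assignment Problem (SeqBAP) for $\mathcal{G}_b$, then $\mathcal{M}$ is a solution to the Bottleneck Assignment Problem (BAP) for $\mathcal{G}_b$.
   Context: Setting: $\mathcal{G}_b=(\mathcal{V}_b,\mathcal{E}_b)$ is a finite undirected bipartite graph with $\mathcal{V}_b=\mathcal{A}_b\cup\mathcal{B}_b$, $\mathcal{A}_b\cap\mathcal{B}_b=\emptyset$, $\emptyset\neq\mathcal{E}_b\subseteq\{\{i,j\}\mid i\in\mathcal{A}_b,j\in\mathcal{B}_b\}$, and weights $w:\mathcal{E}_b\to\mathbb{R}$. A matching is a set of edges no two of which share a vertex; an MCM is a matching of maximum cardinality. $\mathcal{C}(\mathcal{G})$ is the set of MCMs of $\mathcal{G}$, $\mathcal{F}(\mathcal{G})$ is the cardinality of an MCM of $\mathcal{G}$, and $n=\mathcal{F}(\mathcal{G}_b)$. BAP: an MCM $\mathcal{M}\in\mathcal{C}(\mathcal{G}_b)$ is a solution if $\max_{e\in\mathcal{M}}w(e)\le\max_{e\in\mathcal{M}'}w(e)$ for all $\mathcal{M}'\in\mathcal{C}(\mathcal{G}_b)$. Bottleneck weight: $\mathcal{W}(\mathcal{G})=\min_{\mathcal{M}\in\mathcal{C}(\mathcal{G})}\max_{e\in\mathcal{M}}w(e)$.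 Price of absence: for a graph $\mathcal{G}=(\mathcal{V},\mathcal{E})$ and $e\in\mathcal{E}$, $P(\mathcal{G},e)=\mathcal{W}((\mathcal{V},\mathcal{E}\setminus\{e\}))-\mathcal{W}((\mathcal{V},\mathcal{E}))$ if $\mathcal{F}((\mathcal{V},\mathcal{E}))=\mathcal{F}((\mathcal{V},\mathcal{E}\setminus\{e\}))$, and $P(\mathcal{G},e)=+\infty$ otherwise. For a set of edges $\mathcal{E}$, $\mathcal{L}(\mathcal{E})=\arg\max_{e\in\mathcal{E}}w(e)$ (the set of all maximisers). SeqBAP: an MCM $\mathcal{M}\in\mathcal{C}(\mathcal{G}_b)$ is a solution if its edges can be labelled $\{i_1,j_1\},\dots,\{i_n,j_n\}$ (with $i_k\in\mathcal{A}_b$, $j_k\in\mathcal{B}_b$) and there are matchings $\mathcal{M}^1,\dots,\mathcal{M}^n$ such that, with $\mathcal{A}^1=\mathcal{A}_b$, $\mathcal{B}^1=\mathcal{B}_b$, $\mathcal{A}^k=\mathcal{A}^{k-1}\setminus\{i_{k-1}\}$, $\mathcal{B}^k=\mathcal{B}^{k-1}\setminus\{j_{k-1}\}$ for $2\le k\le n$, $\mathcal{E}^k=\{\{i,j\}\in\mathcal{E}_b\mid i\in\mathcal{A}^k,j\in\mathcal{B}^k\}$ and $\mathcal{G}^k=(\mathcal{A}^k\cup\mathcal{B}^k,\mathcal{E}^k)$, for every $k\in\{1,\dots,n\}$: $\mathcal{M}^k\in\arg\min_{\mathcal{M}'\in\mathcal{C}(\mathcal{G}^k)}\max_{e\in\mathcal{M}'}w(e)$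 and $\{i_k,j_k\}\in\arg\max_{e\in\mathcal{L}(\mathcal{M}^k)}P(\mathcal{G}^k,e)$. *)

(* Defs.v *)
From HB Require Import structures.
From mathcomp Require Import all_boot all_order all_algebra.
From mathcomp Require Import constructive_ereal reals.

Set Implicit Arguments.
Unset Strict Implicit.
Unset Printing Implicit Defensive.

Import Order.TTheory GRing.Theory Num.Theory.

Local Open Scope ring_scope.

Definition argmax {d} {T : finType} {X : orderType d} (S : {set T})
    (f : T -> X) : {set T} :=
  [set x in S | [forall y in S, (f y <= f x)%O]].

Definition argmin {d} {T : finType} {X : orderType d} (S : {set T})
    (f : T -> X) : {set T} :=
  [set x in S | [forall y in S, (f x <= f y)%O]].

(* An undirected edge {i, j} is the two-element set [set i; j]. *)
Record graph (V : finType) := Graph {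
  vertices : {set V};
  edges : {set {set V}}
}.

Section Bottleneck.
Variables (R : realType) (V : finType).
Implicit Types (G : graph V) (M S : {set {set V}}) (e : {set V}).

(* trivIset M : distinct elements of M are disjoint. *)
Definition matchings G : {set {set {set V}}} :=
  [set M : {set {set V}} | (M \subset edges G) && trivIset M].

Definition mcm_card G : nat :=
  (\max_(M in matchings G) #|M|)%N.

Definition mcms G : {set {set {set V}}} :=
  [set M in matchings G | #|M| == mcm_card G].

(* Weights are total on {set V}, but every definition below evaluates them
   only at edges of the graph under consideration. *)
Variable w : {set V} -> R.

(* Extended-real valued: the maximum over the empty set is -oo. *)
Definition max_weight M : \bar R := \big[maxe/-oo%E]_(e in M) (w e)%:E.

(* mcms G is never empty and max_weight is never +oo, so the default +oo is
   never the value. *)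
Definition bottleneck_weight G : \bar R :=
  \big[mine/+oo%E]_(M in mcms G) max_weight M.

Definition remove_edge G e : graph V := Graph (vertices G) (edges G :\ e).

(* If e is an edge of G and the cardinalities agree, then the maximum matchings
   of both graphs are nonempty, so the difference is a difference of reals. *)
Definition price_of_absence G e : \bar R :=
  if mcm_card G == mcm_card (remove_edge G e)
  then (bottleneck_weight (remove_edge G e) - bottleneck_weight G)%E
  else +oo%E.

Definition heaviest S : {set {set V}} := argmax S w.

Definition BAP_solution G M : Prop :=
  M \in mcms G /\
  forall M', M' \in mcms G -> (max_weight M <= max_weight M')%E.

Definition bip_edges (A B : {set V}) : {set {set V}} :=
  [set [set i; j] | i in A, j in B].

(* remaining A i k is A minus {i 0, ..., i k.-1}. *)
Fixpoint remaining (A : {set V}) (i : nat -> V) (k : nat) : {set V} :=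
  if k is k'.+1 then remaining A i k' :\ i k' else A.

Definition residual (A B : {set V}) (E : {set {set V}}) (i j : nat -> V)
    (k : nat) : graph V :=
  let Ak := remaining A i k in
  let Bk := remaining B j k in
  Graph (Ak :|: Bk) (E :&: bip_edges Ak Bk).

(* Steps are numbered from 0, so the k-th step of the usual numbering is k.-1
   here; values of i, j and Ms at indices >= mcm_card are irrelevant. *)
Definition SeqBAP_solution (A B : {set V}) (E M : {set {set V}}) : Prop :=
  let G := Graph (A :|: B) E in
  let n := mcm_card G in
  M \in mcms G /\
  exists (i j : nat -> V) (Ms : nat -> {set {set V}}),
    [/\ forall k, (k < n)%N -> i k \in A /\ j k \in B,
        {in [pred k | (k < n)%N] &, injective (fun k => [set i k; j k])},
        M = [set [set i k; j k] | k : 'I_n]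
      & forall k, (k < n)%N ->
          let Gk := residual A B E i j k in
          Ms k \in argmin (mcms Gk) max_weight /\
          [set i k; j k] \in argmax (heaviest (Ms k)) (price_of_absence Gk)].

End Bottleneck.

(* Main.v *)
(* Deleting the two endpoints of an edge e of a maximum matching N leaves the
   maximum matching N :\ e of the residual graph, so the bottleneck weight never
   increases along the sequence of residual graphs.  Each selected edge weighs
   exactly the bottleneck weight of its residual graph, hence at most that of
   the initial graph. *)

Require Import Defs.
From HB Require Import structures.
From mathcomp Require Import all_boot all_order all_algebra.
From mathcomp Require Import constructive_ereal reals.

Set Implicit Arguments.
Unset Strict Implicit.
Unset Printing Implicit Defensive.

Import Order.TTheory GRing.Theory Num.Theory.

Local Open Scope ring_scope.

Lemma leq_card_mcm_card (V : finType) (G : graph V) (M : {set {set V}}) :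
  M \in matchings G -> (#|M| <= mcm_card G)%N.
Proof. by move=> MG; apply: leq_bigmax_cond MG. Qed.

(** For any matching [K] of [H], adding [e] back gives a matching of [G] with one more edge, so
    [#|K| + 1 <= #|N|]; hence [K] has at most as many edges as [N :\ e]. *)
Lemma mcms_delete_edge (V : finType) (G H : graph V) (e : {set V})
    (N : {set {set V}}) :
  edges H = [set f in edges G | [disjoint f & e]] ->
  e != set0 -> e \in N -> N \in mcms G -> N :\ e \in mcms H.
Proof.
move=> EH e0 eN; rewrite !inE => /andP[/andP[NG tN] /eqP cN].
have NH : N :\ e \in matchings H.
  rewrite inE (trivIsetS _ tN) ?subsetDl // andbT EH.
  apply/subsetP => f /setD1P[fe fN]; rewrite inE (subsetP NG) //=.
  exact: (trivIsetP tN).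
move: (NH); rewrite inE => -> /=.
rewrite eqn_leq (leq_card_mcm_card NH) /=.
apply/bigmax_leqP => K; rewrite inE EH => /andP[/subsetP KH tK].
have dK f : f \in K -> [disjoint f & e] by move=> /KH; rewrite inE => /andP[].
(* A nonempty set is not disjoint from itself; so [e |: K] is strictly larger than [K]. *)
have eK : e \notin K.
  by apply: contra e0 => /dK; rewrite -setI_eq0 setIid.
have KG : e |: K \in matchings G.
  rewrite inE subUset sub1set (subsetP NG) //=; apply/andP; split.
    by apply/subsetP => f /KH; rewrite inE => /andP[].
  apply/trivIsetP => f g /setU1P[->|fK] /setU1P[->|gK]; rewrite ?eqxx // => fg.
  - by rewrite disjoint_sym dK.
  - exact: dK.
  - exact: (trivIsetP tK).
by have := leq_card_mcm_card KG; rewrite -cN cardsU1 eK (cardsD1 e N) eN.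
Qed.

Lemma max_weightS (R : realType) (V : finType) (w : {set V} -> R)
    (M N : {set {set V}}) :
  M \subset N -> (max_weight w M <= max_weight w N)%E.
Proof.
move=> /subsetP MN; apply/bigmax_leP; split=> [|f fM]; first exact: leNye.
exact: (le_bigmax_cond _ _ (MN _ fM)).
Qed.

Lemma remaining_subset (V : finType) (A : {set V}) (i : nat -> V) (k : nat) :
  remaining A i k \subset A.
Proof. by elim: k => //= k; apply: subset_trans (subsetDl _ _). Qed.

Lemma residual0 (V : finType) (A B : {set V}) (E : {set {set V}})
    (i j : nat -> V) :
  E \subset bip_edges A B -> residual A B E i j 0 = Graph (A :|: B) E.
Proof. by move=> /setIidPl EE; rewrite /residual /= EE. Qed.

(** As [A] and [B] are disjoint, an edge [[set a; b]] can touch [[set i k; j k]] only through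
    [a = i k] or [b = j k]. This brings consecutive residual graphs into the form that
    [mcms_delete_edge] expects. *)
Lemma edges_residualS (V : finType) (A B : {set V}) (E : {set {set V}})
    (i j : nat -> V) (k : nat) :
  [disjoint A & B] -> i k \in A -> j k \in B ->
  edges (residual A B E i j k.+1) =
  [set f in edges (residual A B E i j k) | [disjoint f & [set i k; j k]]].
Proof.
move=> dAB iA jB.
have AB x y : x \in A -> y \in B -> x != y.
  by move=> xA yB; apply/eqP=> xy; move: (disjointFr dAB xA); rewrite xy yB.
have dE a b : a \in A -> b \in B ->
    [disjoint [set a; b] & [set i k; j k]] = (a != i k) && (b != j k).
  move=> aA bB; rewrite -setI_eq0 setIUl setU_eq0 !setI_eq0 !disjoints1 !inE.
  rewrite (negPf (AB _ _ aA jB)).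
  by rewrite orbF negb_or [b == i k]eq_sym (AB _ _ iA bB).
have sA x := subsetP (remaining_subset A i k) x.
have sB x := subsetP (remaining_subset B j k) x.
apply/setP => f; rewrite !inE -andbA; case: (f \in E) => //=.
apply/imset2P/andP => [[a b /setD1P[ai aA] /setD1P[bj bB] ->]|[]].
  by rewrite dE ?sA ?sB // ai bj; split=> //; apply: imset2_f.
case/imset2P=> a b aA bB ->; rewrite dE ?sA ?sB // => /andP[ai bj].
by exists a b; rewrite // in_setD1 ?ai ?bj.
Qed.

Theorem proposition3 (R : realType) (V : finType) (A B : {set V})
    (E : {set {set V}}) (w : {set V} -> R)
    (hAB : [disjoint A & B]) (hE0 : E != set0) (hE : E \subset bip_edges A B)
    (M : {set {set V}}) (hM : M \in mcms (Graph (A :|: B) E)) :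
  SeqBAP_solution w A B E M -> BAP_solution w (Graph (A :|: B) E) M.
Proof.
case=> _ [i [j [Ms [ijAB _ defM steps]]]]; split=> // M' hM'.
(* The competitor [M'] stays fixed: minimality of [Ms k] transfers the bound from any witness [N] to
   [Ms k]. *)
have optimal k : (k < mcm_card (Graph (A :|: B) E))%N ->
    (exists2 N, N \in mcms (residual A B E i j k) &
       (max_weight w N <= max_weight w M')%E) ->
    [/\ Ms k \in mcms (residual A B E i j k),
        (max_weight w (Ms k) <= max_weight w M')%E
      & [set i k; j k] \in Ms k].
  move=> kn [N NG NM']; have [] := steps k kn.
  move=> /setIdP[MsG /forall_inP opt] /setIdP[/setIdP[eMs _] _].
  by split=> //; apply: le_trans (opt N NG) NM'.
(* The witness is [M'] itself at step 0, where the residual graph is the original one, and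
   afterwards the previous [Ms k] without its selected edge. *)
have bounded k : (k < mcm_card (Graph (A :|: B) E))%N ->
    exists2 N, N \in mcms (residual A B E i j k) &
      (max_weight w N <= max_weight w M')%E.
  elim: k => [|k IHk] kn; first by exists M'; rewrite ?residual0.
  have [MsG MsM' eMs] := optimal k (ltnW kn) (IHk (ltnW kn)).
  have [iA jB] := ijAB k (ltnW kn).
  exists (Ms k :\ [set i k; j k]).
    apply: mcms_delete_edge eMs MsG; first exact: edges_residualS.
    by apply/set0Pn; exists (i k); rewrite set21.
  exact: le_trans (max_weightS w (subsetDl _ _)) MsM'.
(* Besides the starting value [-oo], each edge of [M] has to be bounded; it was selected at some
   step [k], from [Ms k]. *)
apply/bigmax_leP; split=> [|f]; first exact: leNye.
rewrite defM => /imsetP[k _ ->].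
have [_ MsM' eMs] := optimal k (ltn_ord k) (bounded k (ltn_ord k)).
by apply: le_trans MsM'; apply: (le_bigmax_cond _ _ eMs).
Qed.
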